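(* In HoTT, if $(V,\in)\models\mathbf{ZF}$, then LEM holds, i.e. $\prod_{P:U}(\mathrm{isProp}(P)\to(P+\neg P))$ is inhabited.
   Context: Work in HoTT: Martin-Löf type theory with the univalence axiom and higher inductive types, with universes $U:U'$. $\mathrm{isProp}(P):\equiv\prod_{x,y:P}x=y$, $\mathrm{Prop}_U:\equiv\sum_{P:U}\mathrm{isProp}(P)$ (similarly for $U'$). The symbols $\exists,\vee$ denote the propositional truncations of $\Sigma,+$. The cumulative hierarchy $V:U'$ is the higher inductive type with constructors: $\mathsf{set}:\prod_{A:U}(A\to V)\to V$; for all $A,B:U$, $f:A\to V$, $g:B\to V$, a path $\mathsf{set}(A,f)=\mathsf{set}(B,g)$ whenever $(\forall(a:A).\exists(b:B).f(a)=g(b))\wedge(\forall(b:B).\exists(a:A).f(a)=g(b))$; and a $0$-truncation constructor (so $V$ is an h-set). Membership is defined by $x\in\mathsf{set}(A,f):\equiv\exists(a:A).x=f(a)$, a proposition in $U'$. Formulas $\phi$ of the first-order language $\{\in\}$ of set theory are translated into predicates $[\![\phi]\!]_V:V^k\to\mathrm{Prop}_{U'}$ ($k$ the number of free variables) by induction: $x=y$ as the identity type of $V$, $x\in y$ as membership above, $\neg\phi$ as $\phi\to\mathbf 0$, $\to,\wedge,\vee$ as the corresponding operations on propositions ($\vee$ truncated), $\exists x$ and $\forall x$ as the truncated $\exists(x:V)$ and $\prod_{x:V}$. $(V,\in)\models\phi$ means that $\forall(t_1,\dots,t_k:V).[\![\phi]\!]_V(t_1,\dots,t_k)$ is inhabited,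 and $(V,\in)\models S$ for a set $S$ of formulas means $(V,\in)\models\phi$ for all $\phi\in S$. $\mathbf{ZF}$ consists of the usual axioms Extensionality, Empty Set, Pairing, Union, Infinity ($\exists a(\emptyset\in a\wedge\forall y\in a\; y\cup\{y\}\in a)$), Powerset ($\forall v\exists p\forall x(x\in p\iff x\subseteq v)$), the Separation scheme ($\forall a\exists w\forall x(x\in w\iff x\in a\wedge\phi(x))$ for every formula $\phi$), the Replacement scheme ($\forall S(\forall x\exists!y\,\phi(x,y)\Rightarrow\exists w\forall v(v\in w\iff\exists u\in S\,\phi(u,v)))$ for every formula $\phi$), and Foundation ($\forall v(v\neq\emptyset\Rightarrow\exists x(x\in v\wedge x\cap v=\emptyset))$). In the schemes, $\phi$ may have further free variables as parameters. *)

(* Defs.v *)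
From mathcomp Require Import all_boot.
Set Implicit Arguments.
Unset Strict Implicit.
Unset Printing Implicit Defensive.

(** Homotopy type theory as a formal system.

    "In HoTT" is read as derivability, so that no principle of the ambient
    logic leaks into the theory.  The presentation is the first one of the
    appendix of the HoTT Book: untyped terms with unannotated lambdas, a
    convertibility relation on them, a cumulative hierarchy of Russell
    universes, and primitive constants for every type former other than Pi.
    The higher inductive types are propositional truncation and the cumulative
    hierarchy of sets. *)

Inductive cst : Type :=
  | Empty | IndEmpty
  | Unit | Star | IndUnit
  | Nat | Zero | Succ | IndNat
  | Sum | Inl | Inr | IndSum
  | Sig | Pair | IndSig
  | Id | Refl | J
  | UA
  | Tr | TrIn | TrPath | IndTr
  (* [V i] is the cumulative hierarchy relative to the universe [U_i] *)
  | V of nat | SetV of nat | SetExt of nat | SetTrunc of nat | IndV of nat.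

(* de Bruijn indices *)
Inductive tm : Type :=
  | Var of nat
  | Univ of nat
  | Pi of tm & tm
  | Lam of tm
  | App of tm & tm
  | Cst of cst.

Coercion Cst : cst >-> tm.

Definition scons (T : Type) (a : T) (s : nat -> T) (n : nat) : T :=
  if n is m.+1 then s m else a.

Fixpoint ren (r : nat -> nat) (t : tm) : tm :=
  let up := scons 0 (fun n => (r n).+1) in
  match t with
  | Var n => Var (r n)
  | Univ i => Univ i
  | Pi A B => Pi (ren r A) (ren up B)
  | Lam b => Lam (ren up b)
  | App f a => App (ren r f) (ren r a)
  | Cst c => Cst c
  end.

Fixpoint sub (s : nat -> tm) (t : tm) : tm :=
  let up := scons (Var 0) (fun n => ren succn (s n)) in
  match t with
  | Var n => s n
  | Univ i => Univ i
  | Pi A B => Pi (sub s A) (sub up B)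
  | Lam b => Lam (sub up b)
  | App f a => App (sub s f) (sub s a)
  | Cst c => Cst c
  end.

Definition inst (b a : tm) : tm := sub (scons a Var) b.

Notation "f $ a" := (App f a) (at level 11, left associativity).

(* The computation rules of the eliminators.  In the rule for [IndV] the
   recursive calls are the function [fun a => IndV i C h p s (f a)]. *)
Inductive comp_rule : tm -> tm -> Prop :=
  | comp_unit C c : comp_rule (IndUnit $ C $ c $ Star) c
  | comp_zero C z s : comp_rule (IndNat $ C $ z $ s $ Zero) z
  | comp_succ C z s n :
      comp_rule (IndNat $ C $ z $ s $ (Succ $ n))
        (s $ n $ (IndNat $ C $ z $ s $ n))
  | comp_inl A B C l r a :
      comp_rule (IndSum $ A $ B $ C $ l $ r $ (Inl $ A $ B $ a)) (l $ a)
  | comp_inr A B C l r b :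
      comp_rule (IndSum $ A $ B $ C $ l $ r $ (Inr $ A $ B $ b)) (r $ b)
  | comp_sig A B C g a b :
      comp_rule (IndSig $ A $ B $ C $ g $ (Pair $ A $ B $ a $ b)) (g $ a $ b)
  | comp_J A C c x : comp_rule (J $ A $ C $ c $ x $ x $ (Refl $ A $ x)) (c $ x)
  | comp_tr A C p c a : comp_rule (IndTr $ A $ C $ p $ c $ (TrIn $ A $ a)) (c $ a)
  | comp_V i C h p s A f :
      comp_rule (IndV i $ C $ h $ p $ s $ (SetV i $ A $ f))
        (h $ A $ f
           $ Lam (ren succn (IndV i $ C $ h $ p $ s)
                    $ (ren succn f $ Var 0))).

Inductive conv : tm -> tm -> Prop :=
  | conv_refl t : conv t t
  | conv_sym t u : conv t u -> conv u t
  | conv_trans t u v : conv t u -> conv u v -> conv t v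
  | conv_Pi A A' B B' : conv A A' -> conv B B' -> conv (Pi A B) (Pi A' B')
  | conv_Lam b b' : conv b b' -> conv (Lam b) (Lam b')
  | conv_App f f' a a' : conv f f' -> conv a a' -> conv (f $ a) (f' $ a')
  | conv_beta b a : conv (Lam b $ a) (inst b a)
  | conv_eta f : conv (Lam (ren succn f $ Var 0)) f
  | conv_comp t u : comp_rule t u -> conv t u.

(** Higher-order notation for raw terms.

    A [Tm] is a term given as a function of the number [d] of binders above
    it; a variable bound at depth [k] has index [d - k.+1] at depth [d].  A
    closed [t : Tm] stands for the term [t 0]. *)

Definition Tm : Type := nat -> tm.

Declare Scope hott_scope.
Delimit Scope hott_scope with hott.
Bind Scope hott_scope with Tm.

Definition bound (k : nat) : Tm := fun d => Var (d - k.+1).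
Definition pi (A : Tm) (B : Tm -> Tm) : Tm :=
  fun d => Pi (A d) (B (bound d) d.+1).
Definition lam (b : Tm -> Tm) : Tm := fun d => Lam (b (bound d) d.+1).
Definition app (f a : Tm) : Tm := fun d => f d $ a d.
Definition univ (i : nat) : Tm := fun _ => Univ i.
Definition closed (t : tm) : Tm := fun _ => t.
Definition con (c : cst) : Tm := closed c.

Notation "'Π' x : A , B" := (pi A (fun x => B))
  (at level 200, x name, A at level 99, B at level 200, right associativity)
  : hott_scope.
Notation "'λ' x , b" := (lam (fun x => b))
  (at level 200, x name, b at level 200, right associativity) : hott_scope.
Notation "f · a" := (app f a) (at level 11, left associativity) : hott_scope.
Notation "A ~> B" := (pi A (fun _ => B))
  (at level 55, right associativity) : hott_scope.

Local Open Scope hott_scope.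

Definition sig (A : Tm) (B : Tm -> Tm) : Tm := con Sig · A · lam B.
Definition times (A B : Tm) : Tm := sig A (fun _ => B).
Definition tpair (A : Tm) (B : Tm -> Tm) (a b : Tm) : Tm :=
  con Pair · A · lam B · a · b.
Definition pr1 (A : Tm) (B : Tm -> Tm) (u : Tm) : Tm :=
  con IndSig · A · lam B · (λ _, A) · (λ a, λ _, a) · u.
Definition coprod (A B : Tm) : Tm := con Sum · A · B.
Definition neg (A : Tm) : Tm := A ~> con Empty.
Definition eqt (A x y : Tm) : Tm := con Id · A · x · y.
Definition refl (A x : Tm) : Tm := con Refl · A · x.

Definition tr (A : Tm) : Tm := con Tr · A.
Definition ex (A : Tm) (B : Tm -> Tm) : Tm := tr (sig A B).
Definition disj (A B : Tm) : Tm := tr (coprod A B).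

Notation "'Σ' x : A , B" := (sig A (fun x => B))
  (at level 200, x name, A at level 99, B at level 200, right associativity)
  : hott_scope.
Notation "'∃' x : A , B" := (ex A (fun x => B))
  (at level 200, x name, A at level 99, B at level 200, right associativity)
  : hott_scope.

Definition isProp (A : Tm) : Tm := Π x : A, Π y : A, eqt A x y.
Definition isSet (A : Tm) : Tm := Π x : A, Π y : A, isProp (eqt A x y).
Definition PropU (i : nat) : Tm := Σ P : univ i, isProp P.

Definition transport (A : Tm) (P : Tm -> Tm) (x y p u : Tm) : Tm :=
  con J · A · (λ x', λ y', λ _, P x' ~> P y') · (λ _, λ v, v) · x · y · p · u.

(* An equivalence is a map with contractible fibres. *)
Definition isContr (A : Tm) : Tm := Σ a : A, Π x : A, eqt A a x.
Definition fib (A B f y : Tm) : Tm := Σ x : A, eqt B (f · x) y.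
Definition isEquiv (A B f : Tm) : Tm := Π y : B, isContr (fib A B f y).
Definition eqv (A B : Tm) : Tm := Σ f : A ~> B, isEquiv A B f.

(* The proof that the identity map of [A] has contractible fibres. *)
Definition id_isEquiv (A : Tm) : Tm :=
  let F y := fib A A (λ x, x) y in
  let pt y x p := tpair A (fun x' => eqt A x' y) x p in
  λ y, tpair (F y) (fun c => Π w : F y, eqt (F y) c w)
    (pt y y (refl A y))
    (λ w, con IndSig · A · (λ x, eqt A x y)
            · (λ w', eqt (F y) (pt y y (refl A y)) w')
            · (λ x, λ p,
                 con J · A
                   · (λ x', λ y', λ q,
                        eqt (F y') (pt y' y' (refl A y')) (pt y' x' q))
                   · (λ x', refl (F x') (pt x' x' (refl A x')))
                   · x · y · p)
            · w).

Definition idtoeqv (i : nat) (A B : Tm) : Tm :=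
  λ p, con J · univ i · (λ X, λ Y, λ _, eqv X Y)
         · (λ X, tpair (X ~> X) (fun f => isEquiv X X f) (λ x, x) (id_isEquiv X))
         · A · B · p.

Definition Vt (i : nat) : Tm := con (V i).
Definition setV (i : nat) (A f : Tm) : Tm := con (SetV i) · A · f.

(* Premise of the path constructor of [V]. *)
Definition bisim (i : nat) (A B f g : Tm) : Tm :=
  times (Π a : A, ∃ b : B, eqt (Vt i) (f · a) (g · b))
       (Π b : B, ∃ a : A, eqt (Vt i) (f · a) (g · b)).

(* The motive of [IndTr] is a family of propositions, and that of [IndV] a
   family of sets, so the propositional computation rules for the path
   constructors hold automatically and are not listed. *)
Definition IndTr_ty (i j : nat) : Tm :=
  Π A : univ i, Π C : tr A ~> univ j,
    (Π x : tr A, isProp (C · x)) ~>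
    (Π a : A, C · (con TrIn · A · a)) ~>
    Π x : tr A, C · x.

Definition IndV_ty (i j : nat) : Tm :=
  let over C x y p u v := eqt (C · y) (transport (Vt i) (app C) x y p u) v in
  Π C : Vt i ~> univ j,
  Π h : (Π A : univ i, Π f : A ~> Vt i,
           (Π a : A, C · (f · a)) ~> C · setV i A f),
    (Π A : univ i, Π B : univ i, Π f : A ~> Vt i, Π g : B ~> Vt i,
     Π e : bisim i A B f g,
     Π hf : (Π a : A, C · (f · a)), Π hg : (Π b : B, C · (g · b)),
       times (Π a : A, ∃ b : B, ∃ p : eqt (Vt i) (f · a) (g · b),
               over C (f · a) (g · b) p (hf · a) (hg · b))
            (Π b : B, ∃ a : A, ∃ p : eqt (Vt i) (f · a) (g · b),
               over C (f · a) (g · b) p (hf · a) (hg · b)) ~>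
       over C (setV i A f) (setV i B g) (con (SetExt i) · A · B · f · g · e)
         (h · A · f · hf) (h · B · g · hg)) ~>
    (Π x : Vt i, isSet (C · x)) ~>
    Π x : Vt i, C · x.

(* Types of the constants, schematic in the universe levels: [i] is the level
   of the parameters and [j] that of the motive of an eliminator. *)
Definition cst_ty (c : cst) (i j : nat) : Tm :=
  match c with
  | Empty => univ i
  | IndEmpty => Π C : con Empty ~> univ j, Π x : con Empty, C · x
  | Unit => univ i
  | Star => con Unit
  | IndUnit =>
      Π C : con Unit ~> univ j, C · con Star ~> Π x : con Unit, C · x
  | Nat => univ i
  | Zero => con Nat
  | Succ => con Nat ~> con Nat
  | IndNat =>
      Π C : con Nat ~> univ j,
        C · con Zero ~>
        (Π n : con Nat, C · n ~> C · (con Succ · n)) ~>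
        Π n : con Nat, C · n
  | Sum => univ i ~> univ i ~> univ i
  | Inl => Π A : univ i, Π B : univ i, A ~> coprod A B
  | Inr => Π A : univ i, Π B : univ i, B ~> coprod A B
  | IndSum =>
      Π A : univ i, Π B : univ i, Π C : coprod A B ~> univ j,
        (Π a : A, C · (con Inl · A · B · a)) ~>
        (Π b : B, C · (con Inr · A · B · b)) ~>
        Π x : coprod A B, C · x
  | Sig => Π A : univ i, (A ~> univ i) ~> univ i
  | Pair =>
      Π A : univ i, Π B : A ~> univ i,
      Π a : A, B · a ~> con Sig · A · B
  | IndSig =>
      Π A : univ i, Π B : A ~> univ i, Π C : con Sig · A · B ~> univ j,
        (Π a : A, Π b : B · a, C · (con Pair · A · B · a · b)) ~>
        Π x : con Sig · A · B, C · x
  | Id => Π A : univ i, A ~> A ~> univ i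
  | Refl => Π A : univ i, Π x : A, eqt A x x
  | J =>
      Π A : univ i, Π C : (Π x : A, Π y : A, eqt A x y ~> univ j),
        (Π x : A, C · x · x · refl A x) ~>
        Π x : A, Π y : A, Π p : eqt A x y, C · x · y · p
  | UA =>
      Π A : univ i, Π B : univ i,
        isEquiv (eqt (univ i) A B) (eqv A B) (idtoeqv i A B)
  | Tr => univ i ~> univ i
  | TrIn => Π A : univ i, A ~> tr A
  | TrPath => Π A : univ i, isProp (tr A)
  | IndTr => IndTr_ty i j
  | V k => univ k.+1
  | SetV k => Π A : univ k, (A ~> Vt k) ~> Vt k
  | SetExt k =>
      Π A : univ k, Π B : univ k, Π f : A ~> Vt k, Π g : B ~> Vt k,
        bisim k A B f g ~> eqt (Vt k) (setV k A f) (setV k B g)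
  | SetTrunc k => isSet (Vt k)
  | IndV k => IndV_ty k j
  end.

Inductive wf : seq tm -> Prop :=
  | wf_nil : wf [::]
  | wf_cons G A i : typ G A (Univ i) -> wf (A :: G)

with typ : seq tm -> tm -> tm -> Prop :=
  | typ_Var G n A : wf G -> onth G n = Some A ->
      typ G (Var n) (ren (addn n.+1) A)
  | typ_Cst G c i j : wf G -> typ G (Cst c) (cst_ty c i j 0)
  | typ_Univ G i : wf G -> typ G (Univ i) (Univ i.+1)
  | typ_cumul G A i : typ G A (Univ i) -> typ G A (Univ i.+1)
  | typ_Pi G A B i : typ G A (Univ i) -> typ (A :: G) B (Univ i) ->
      typ G (Pi A B) (Univ i)
  | typ_Lam G A B b : typ (A :: G) b B -> typ G (Lam b) (Pi A B)
  | typ_App G A B f a : typ G f (Pi A B) -> typ G a A ->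
      typ G (f $ a) (inst B a)
  | typ_conv G A B t i : typ G t A -> conv A B -> typ G B (Univ i) ->
      typ G t B.

(* The closed type [C] is inhabited in HoTT extended by the hypotheses that
   the closed types in [H] are inhabited; a derivation uses finitely many of
   them, which form its context. *)
Definition inhabited_from (H : tm -> Prop) (C : tm) : Prop :=
  exists (G : seq tm) (t : tm),
    (forall n T, onth G n = Some T -> H T) /\ typ G t C.

Definition LEM (i : nat) : Tm := Π P : univ i, isProp P ~> coprod P (neg P).

(* Formulas of the language {∈}; variables are named by natural numbers. *)

Inductive form : Type :=
  | FEq of nat & nat
  | FIn of nat & nat
  | FNot of form
  | FImp of form & form
  | FAnd of form & form
  | FOr of form & form
  | FEx of nat & form
  | FAll of nat & form.

Fixpoint fv (phi : form) : seq nat :=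
  match phi with
  | FEq x y | FIn x y => [:: x; y]
  | FNot p => fv p
  | FImp p q | FAnd p q | FOr p q => fv p ++ fv q
  | FEx x p | FAll x p => [seq y <- fv p | y != x]
  end.

(* [mem] is a membership relation on [V] if it has type [V -> V -> Prop_{U'}],
   with [U = U_i] and [U' = U_{i+1}], and satisfies the defining equation
   x ∈ set(A, f) :≡ ∃ (a : A), x = f(a).  Taking any such term avoids fixing a
   proof that this clause respects the path constructor. *)
Definition inV (i : nat) (mem x y : Tm) : Tm :=
  pr1 (univ i.+1) isProp (mem · x · y).

Definition is_membership (i : nat) (mem : tm) : Prop :=
  typ [::] mem ((Vt i ~> Vt i ~> PropU i.+1) 0) /\
  conv ((λ x, λ A, λ f, inV i (closed mem) x (setV i A f)) 0)
       ((λ x, λ A, λ f, ∃ a : A, eqt (Vt i) x (f · a)) 0).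

Definition upd (rho : nat -> Tm) (x : nat) (t : Tm) : nat -> Tm :=
  fun y => if y == x then t else rho y.

(* The type underlying the proposition [[phi]]_V at the assignment [rho]. *)
Fixpoint sem (i : nat) (mem : Tm) (phi : form) (rho : nat -> Tm) : Tm :=
  match phi with
  | FEq x y => eqt (Vt i) (rho x) (rho y)
  | FIn x y => inV i mem (rho x) (rho y)
  | FNot p => neg (sem i mem p rho)
  | FImp p q => sem i mem p rho ~> sem i mem q rho
  | FAnd p q => times (sem i mem p rho) (sem i mem q rho)
  | FOr p q => disj (sem i mem p rho) (sem i mem q rho)
  | FEx x p => ∃ t : Vt i, sem i mem p (upd rho x t)
  | FAll x p => Π t : Vt i, sem i mem p (upd rho x t)
  end.

Fixpoint univ_closure (i : nat) (xs : seq nat) (T : (nat -> Tm) -> Tm)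
    (rho : nat -> Tm) : Tm :=
  if xs is x :: xs' then Π t : Vt i, univ_closure i xs' T (upd rho x t)
  else T rho.

(* The type expressing (V, ∈) ⊨ phi.  The initial assignment is irrelevant, as
   all free variables are quantified. *)
Definition models (i : nat) (mem : Tm) (phi : form) : Tm :=
  univ_closure i (undup (fv phi)) (sem i mem phi) (fun _ => con Star).

Definition FIff (p q : form) : form := FAnd (FImp p q) (FImp q p).
Definition FAllIn (x a : nat) (p : form) : form := FAll x (FImp (FIn x a) p).
Definition FExIn (x a : nat) (p : form) : form := FEx x (FAnd (FIn x a) p).

(* There is a unique [x] with [p]; the variable [z] must not occur in [p]. *)
Definition FExUniq (x z : nat) (p : form) : form :=
  FEx z (FAll x (FIff p (FEq x z))).

(* [x] is empty, with auxiliary variable [z] *)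
Definition FEmpty (x z : nat) : form := FAll z (FNot (FIn z x)).

(* ∅, y ∪ {y}, ⊆ and x ∩ v = ∅ are unfolded into the language {∈}.  The schemes
   quantify over the free variable names of [phi] itself, so that no
   substitution is needed; any other free variable of [phi] is a parameter. *)
Inductive ZF : form -> Prop :=
  | zf_extensionality :
      ZF (FAll 0 (FAll 1 (FImp
            (FAll 2 (FIff (FIn 2 0) (FIn 2 1)))
            (FEq 0 1))))
  | zf_empty_set : ZF (FEx 0 (FEmpty 0 1))
  | zf_pairing :
      ZF (FAll 0 (FAll 1 (FEx 2 (FAll 3
            (FIff (FIn 3 2) (FOr (FEq 3 0) (FEq 3 1)))))))
  | zf_union :
      ZF (FAll 0 (FEx 1 (FAll 2
            (FIff (FIn 2 1) (FExIn 3 0 (FIn 2 3))))))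
  | zf_infinity :
      ZF (FEx 0 (FAnd
            (FExIn 1 0 (FEmpty 1 2))
            (FAllIn 1 0 (FExIn 2 0
               (FAll 3 (FIff (FIn 3 2) (FOr (FIn 3 1) (FEq 3 1))))))))
  | zf_powerset :
      ZF (FAll 0 (FEx 1 (FAll 2
            (FIff (FIn 2 1) (FAllIn 3 2 (FIn 3 0))))))
  | zf_separation (phi : form) (x a w : nat) :
      uniq [:: x; a; w] -> w \notin fv phi ->
      ZF (FAll a (FEx w (FAll x
            (FIff (FIn x w) (FAnd (FIn x a) phi)))))
  | zf_replacement (phi : form) (x y z s w : nat) :
      uniq [:: x; y; z; s; w] -> z \notin fv phi -> w \notin fv phi ->
      ZF (FAll s (FImp
            (FAll x (FExUniq y z phi))
            (FEx w (FAll y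
               (FIff (FIn y w) (FExIn x s phi))))))
  | zf_foundation :
      ZF (FAll 0 (FImp
            (FNot (FEmpty 0 1))
            (FEx 1 (FAnd (FIn 1 0)
               (FAll 2 (FNot (FAnd (FIn 2 1) (FIn 2 0)))))))).

Definition V_models_ZF (i : nat) (mem : tm) (T : tm) : Prop :=
  exists2 phi, ZF phi & T = models i (closed mem) phi 0.

(* Main.v *)
From mathcomp Require Import all_boot.
Require Import Defs.
Set Implicit Arguments.
Unset Strict Implicit.
Unset Printing Implicit Defensive.

(** Foundation, applied to a suitable set, decides a given proposition [P] in
    [U_i].  Let [e] be the empty set and [one] its singleton, and consider

      v = {e | P} ∪ {one},

    that is, [set (P + 1, f)] where [f] sends the left summand to [e] and the
    right one to [one].  It contains [one], so Foundation yields some [x] in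
    [v] disjoint from [v].  If [x] comes from the left summand, then [P] holds.
    If [x = one], then [e] belongs to [x]; were [P] true, [e] would belong to
    [v] as well, so [P] fails.

    The existentials are truncated, so this argument has to end in a
    proposition.  Proving that [P + ¬P] is one would need function
    extensionality for [¬P].  The argument is therefore carried out with
    [P + ‖¬P‖], whose two summands are propositions by assumption and by
    construction and exclude each other; afterwards [‖¬P‖] gives back [¬P],
    because [Empty] is a proposition.

    In the formal system this is a closed term [lem_term] that proves

      Π mem, (introduction and elimination for x ∈ set(A, f)) ~>
             Foundation for mem ~> LEM

    with a bound variable in place of the membership relation.  So its typing
    derivation is about a concrete term and is found by a type-checking tactic
    ([typecheck]), whose conversion problems are decided by normalisation
    ([conv_nf]).  The given relation [mem] enters only at the end.  Its defining
    equation makes introduction and elimination the identity function, and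
    since [mem] is closed, renaming and substitution do not change it
    ([typ_ren], [typ_sub]) and it can be typed in every context
    ([typ_weaken]).  The context of the final derivation is the single
    hypothesis that [V] models Foundation. *)

(** * Closed terms and weakening *)

Scheme typ_mut := Induction for typ Sort Prop
  with wf_mut := Induction for wf Sort Prop.

(** Hypotheses are added at the far end of the context, which leaves all
    de Bruijn indices unchanged: no renaming is involved. *)
Lemma typ_weaken D (wfD : wf D) G t A : typ G t A -> typ (G ++ D) t A.
Proof.
move=> tA.
apply: (typ_mut (P := fun G t A _ => typ (G ++ D) t A)
  (P0 := fun G _ => wf (G ++ D))) tA => //=.
- move=> {}G n {}A _ wfGD GnA; apply: typ_Var => //.
  rewrite onth_cat; case: ltnP => // /onth_default; congruence.
- by move=> *; apply: typ_Cst.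
- by move=> *; apply: typ_Univ.
- by move=> *; apply: typ_cumul.
- by move=> *; apply: typ_Pi.
- by move=> *; apply: typ_Lam.
- by move=> *; apply: typ_App; eassumption.
- by move=> *; apply: typ_conv; eassumption.
- by move=> *; apply: wf_cons; eassumption.
Qed.

(** A typed term only mentions the variables of its context; for the empty
    context these two lemmas say that it is closed. *)
Lemma typ_ren G t A : typ G t A ->
  forall r, (forall n, n < size G -> r n = n) -> ren r t = t.
Proof.
have up (B : tm) D (r : nat -> nat) : (forall n, n < size D -> r n = n) ->
    forall n, n < size (B :: D) -> scons 0 (fun n => (r n).+1) n = n.
  by move=> rD [|n] //= /rD ->.
elim=> {G t A} //=.
- move=> G n A _ GnA r -> //.
  by case: ltnP => // /onth_default; congruence.
- by move=> G A B j _ IHA _ IHB r rG; rewrite IHA // IHB //; apply: up.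
- by move=> G A B b _ IHb r rG; rewrite IHb //; apply: up.
- by move=> G A B f a _ IHf _ IHa r rG; rewrite IHf // IHa.
Qed.

Lemma typ_sub G t A : typ G t A ->
  forall s, (forall n, n < size G -> s n = Var n) -> sub s t = t.
Proof.
have up (B : tm) D (s : nat -> tm) : (forall n, n < size D -> s n = Var n) ->
    forall n, n < size (B :: D) ->
    scons (Var 0) (fun n => ren succn (s n)) n = Var n.
  by move=> sD [|n] //= /sD ->.
elim=> {G t A} //=.
- move=> G n A _ GnA s -> //.
  by case: ltnP => // /onth_default; congruence.
- by move=> G A B j _ IHA _ IHB s sG; rewrite IHA // IHB //; apply: up.
- by move=> G A B b _ IHb s sG; rewrite IHb //; apply: up.
- by move=> G A B f a _ IHf _ IHa s sG; rewrite IHf // IHa.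
Qed.

Lemma sub_renK t r s : (forall n, s (r n) = Var n) -> sub s (ren r t) = t.
Proof.
elim: t r s => //= [A IHA B IHB|b IHb|f IHf a IHa] r s sr.
- by rewrite IHA // IHB // => -[|n] //=; rewrite sr.
- by rewrite IHb // => -[|n] //=; rewrite sr.
- by rewrite IHf // IHa.
Qed.

(** * Normalisation *)

Definition tm_eq_dec (t u : tm) : {t = u} + {t <> u}.
Proof. by repeat decide equality. Defined.

(** Besides beta, only the rules for [IndSum] are implemented: they compute the
    family of elements of {e | P} ∪ {one}. *)
Definition head_step (t : tm) : option tm :=
  match t with
  | Lam b $ a => Some (inst b a)
  | Cst IndSum $ A $ B $ C $ l $ r $ (Cst Inl $ A' $ B' $ a) =>
      if tm_eq_dec A A' is left _ then
        if tm_eq_dec B B' is left _ then Some (l $ a) else None else None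
  | Cst IndSum $ A $ B $ C $ l $ r $ (Cst Inr $ A' $ B' $ b) =>
      if tm_eq_dec A A' is left _ then
        if tm_eq_dec B B' is left _ then Some (r $ b) else None else None
  | _ => None
  end.

Arguments head_step : simpl never.

(** The fuel [n] bounds the depth of the recursion.  It need not suffice to
    reach a normal form: every intermediate result is convertible to [t]. *)
Fixpoint nf (n : nat) (t : tm) : tm :=
  if n isn't m.+1 then t else
  match t with
  | Pi A B => Pi (nf m A) (nf m B)
  | Lam b => Lam (nf m b)
  | f $ a =>
      let t' := nf m f $ nf m a in
      if head_step t' is Some u then nf m u else t'
  | _ => t
  end.

Lemma head_step_conv t u : head_step t = Some u -> conv t u.
Proof.
rewrite /head_step.
repeat match goal with
| |- context [match ?x with _ => _ end] => is_var x; destruct x => //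
| |- context [match ?x with _ => _ end] => destruct x => //; subst
end; move=> [<-]; first [exact: conv_beta | apply: conv_comp; constructor].
Qed.

Lemma nf_conv n t : conv t (nf n t).
Proof.
elim: n t => [|n IHn] t /=; first exact: conv_refl.
case: t => [k|k|A B|b|f a|c]; try exact: conv_refl.
- exact: conv_Pi.
- exact: conv_Lam.
- move: (conv_App (IHn f) (IHn a)); case E: head_step => [u|//] c.
  exact: conv_trans c (conv_trans (head_step_conv E) (IHn u)).
Qed.

Lemma conv_nf n t u : nf n t = nf n u -> conv t u.
Proof.
by move=> e; apply: conv_trans (nf_conv n t) _; rewrite e; apply/conv_sym/nf_conv.
Qed.

(** * Typing rules for the type formers

    The rules for binders pass the well-formedness of the extended context on
    to the premise for the body, so that the leaves of a derivation find it
    among the hypotheses. *)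

Lemma typ_le G A i j : typ G A (Univ i) -> i <= j -> typ G A (Univ j).
Proof.
move=> tA /subnKC <-; elim: (j - i) => [|k IHk]; first by rewrite addn0.
by rewrite addnS; exact: typ_cumul.
Qed.

Lemma typ_eq G t A B : typ G t A -> A = B -> typ G t B.
Proof. by move=> tA <-. Qed.

Lemma typ_Pi' G A B i : typ G A (Univ i) ->
  (wf (A :: G) -> typ (A :: G) B (Univ i)) -> typ G (Pi A B) (Univ i).
Proof. by move=> tA tB; apply: typ_Pi => //; apply: tB; exact: wf_cons tA. Qed.

Lemma typ_Lam' G A B b i : typ G A (Univ i) ->
  (wf (A :: G) -> typ (A :: G) b B) -> typ G (Lam b) (Pi A B).
Proof. by move=> tA tb; apply: typ_Lam; apply: tb; exact: wf_cons tA. Qed.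

Lemma typ_Univ_lt G j k : wf G -> j < k -> typ G (Univ j) (Univ k).
Proof. by move=> wfG; apply: typ_le; exact: typ_Univ. Qed.

Lemma typ_Empty G i : wf G -> typ G Empty (Univ i).
Proof. exact: (@typ_Cst G Empty i i). Qed.

Lemma typ_Unit G i : wf G -> typ G Unit (Univ i).
Proof. exact: (@typ_Cst G Unit i i). Qed.

Lemma typ_V G j k : wf G -> j < k -> typ G (V j) (Univ k).
Proof. by move=> wfG; apply: typ_le; exact: (@typ_Cst G (V j) 0 0). Qed.

Lemma typ_app G f a A B C : typ G f (Pi A B) -> typ G a A -> inst B a = C ->
  typ G (f $ a) C.
Proof. by move=> tf ta <-; exact: typ_App tf ta. Qed.

Lemma typ_Tr G A i : wf G -> typ G A (Univ i) -> typ G (Tr $ A) (Univ i).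
Proof. by move=> wfG tA; apply: typ_app (typ_Cst Tr i i wfG) tA _. Qed.

Lemma typ_Sum G A B i : wf G -> typ G A (Univ i) -> typ G B (Univ i) ->
  typ G (Sum $ A $ B) (Univ i).
Proof.
move=> wfG tA tB.
by apply: typ_app (typ_app (typ_Cst Sum i i wfG) tA (erefl _)) tB _.
Qed.

Lemma typ_Sig G A B i : wf G -> typ G A (Univ i) ->
  (wf (A :: G) -> typ (A :: G) B (Univ i)) ->
  typ G (Sig $ A $ Lam B) (Univ i).
Proof.
move=> wfG tA tB.
apply: typ_app (typ_app (typ_Cst Sig i i wfG) tA (erefl _)) _ _ => //.
exact: typ_Lam' tA tB.
Qed.

Lemma typ_Id G A x y i : wf G -> typ G A (Univ i) -> typ G x A -> typ G y A ->
  typ G (Id $ A $ x $ y) (Univ i).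
Proof.
move=> wfG tA tx ty.
have tIx : typ G (Id $ A $ x) (Pi A (Univ i)).
  apply: typ_app (typ_app (typ_Cst Id i i wfG) tA (erefl _)) tx _.
  by rewrite /inst /= sub_renK.
exact: typ_app tIx ty (erefl _).
Qed.

(** * A type-checking tactic

    The algorithm is bidirectional.  [check_type L l] proves that a type
    lies in [Univ l], [check L] proves [typ G t T] for a given [T], and [infer L]
    finds the type of a variable, a constant or an application.  Eliminators
    and constructors carry no universe levels and universes are cumulative, so
    one large level [L] serves for the parameters and the motives of all of
    them; only type formers are checked at the exact level [l]. *)

Ltac leq_tac := repeat first [exact: leqnn | apply: leqW].

Ltac eval_tac :=
  lazymatch goal with |- ?X = _ =>
    let Y := eval vm_compute in X in exact (@erefl _ Y) end.

Ltac conv_tac := apply: (@conv_nf 100); vm_compute; reflexivity.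

Ltac is_redex t :=
  lazymatch t with
  | Lam _ $ _ => idtac
  | ?f $ _ => is_redex f
  end.

(* A place for the typing rule of a defined type former; the goals that the
   rule leaves are passed to [check]. *)
Ltac type_rule := fail.

Ltac check_type L l :=
  lazymatch goal with |- typ ?G ?A _ =>
  lazymatch A with
  | Univ _ => apply: typ_Univ_lt; [assumption | leq_tac]
  | Pi _ _ => apply: typ_Pi'; [check_type L l | intro; check_type L l]
  | Cst Empty => apply: typ_Empty; assumption
  | Cst Unit => apply: typ_Unit; assumption
  | Cst (V _) => apply: typ_V; [assumption | leq_tac]
  | Cst Sum $ _ $ _ =>
      apply: typ_Sum; [assumption | check_type L l | check_type L l]
  | Cst Tr $ _ => apply: typ_Tr; [assumption | check_type L l]
  | Cst Sig $ _ $ Lam _ =>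
      apply: typ_Sig; [assumption | check_type L l | intro; check_type L l]
  | Cst Id $ _ $ _ $ _ =>
      apply: typ_Id; [assumption | check_type L l | check L | check L]
  | _ => tryif type_rule then check L else tryif is_redex A then check_redex L
         else (eapply typ_le; [infer L | leq_tac])
  end end
(* An unannotated abstraction has no inferred type, so in [Lam b $ a] the type
   of [a] provides the domain, and the codomain is taken constant. *)
with check_redex L :=
  lazymatch goal with |- typ ?G (?f $ ?a) ?T =>
    let H := fresh "H" in
    eassert (H : typ G a _) by infer L;
    lazymatch type of H with typ _ _ ?A =>
      let T1 := eval vm_compute in (ren succn T) in
      apply: (@typ_app G f a A T1 T); [check L | exact H | reflexivity]
    end
  end
with check L :=
  lazymatch goal with |- typ ?G ?t ?T =>
    let T1 := eval vm_compute in (nf 100 T) in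
    tryif constr_eq T T1 then check_nf L
    else (apply: (@typ_conv G T1 T t L); [check_nf L | conv_tac | check_type L L])
  end
with check_nf L :=
  lazymatch goal with |- typ ?G ?t ?T =>
  lazymatch T with
  | Univ ?l => check_type L l
  | _ =>
    lazymatch t with
    | Lam _ => apply: (@typ_Lam' _ _ _ _ L); [check_type L L | intro; check L]
    | _ => tryif is_redex t then check_redex L else
       (let H := fresh "H" in
        eassert (H : typ G t _) by infer L;
        lazymatch type of H with typ _ _ ?T1 =>
          tryif constr_eq T T1 then exact H
          else (apply: (@typ_conv G T1 T t L);
                [exact H | conv_tac | check_type L L])
        end)
    end
  end end
with infer L :=
  lazymatch goal with |- typ ?G ?t _ =>
  lazymatch t with
  | Var _ =>
      eapply typ_eq; [eapply typ_Var; [eassumption | reflexivity] | eval_tac]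
  | Cst ?c => eapply typ_eq; [apply: (@typ_Cst G c L L); assumption | eval_tac]
  | ?f $ ?a =>
    let H := fresh "H" in
    eassert (H : typ G t _) by
      (eapply typ_app; [infer L | check L | eval_tac]);
    lazymatch type of H with typ _ _ ?T =>
      tryif is_redex T then
        let T1 := eval vm_compute in (nf 100 T) in
        apply: (@typ_conv G T T1 t L); [exact H | conv_tac | check_type L L]
      else exact H
    end
  (* an opaque closed term, whose typing in every context is a hypothesis *)
  | _ => lazymatch goal with tt : forall D, wf D -> typ D t _ |- _ =>
      apply: tt; assumption end
  end end.

Ltac typecheck L :=
  lazymatch goal with |- typ ?G ?t ?T =>
    let t1 := eval vm_compute in t in
    let T1 := eval vm_compute in T in
    change (typ G t1 T1)
  end; check L.

Local Open Scope hott_scope.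

(** * Membership as a defined type former *)

Definition mem_rel (i : nat) : Tm := Vt i ~> Vt i ~> PropU i.+1.

Definition elem (i : nat) (m x y : tm) : tm :=
  inV i (closed m) (closed x) (closed y) 0.

(** With this rule the tactic does not have to type the first projection anew
    at each occurrence of a membership. *)
Lemma typ_elem G i m x y : wf G -> typ G m (mem_rel i 0) ->
  typ G x (V i) -> typ G y (V i) -> typ G (elem i m x y) (Univ i.+1).
Proof.
move=> wfG tm tx ty.
pose u := Univ i.+1; pose isp := ((lam isProp) 0).
have t_pr1 : typ G (IndSig $ u $ isp $ Lam u $ Lam (Lam (Var 1)))
    (Pi (Sig $ u $ isp) u).
  by rewrite /u /isp; typecheck i.+2.
apply: typ_app t_pr1 _ (erefl _).
exact: typ_app (typ_app tm tx (erefl _)) ty (erefl _).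
Qed.

Ltac type_rule ::=
  lazymatch goal with |- typ ?G ?A _ =>
  lazymatch A with
  | Cst IndSig $ Univ (S ?k) $ _ $ _ $ _ $ (?m $ ?x $ ?y) =>
      let T := eval vm_compute in (mem_rel k 0) in
      apply: (@typ_le _ _ k.+1);
      [apply: (@typ_elem G k m x y); [assumption | change (typ G m T) | |]
      | leq_tac]
  end end.

(** * Propositional truncation and decisions *)

Definition tr_rec (A X h c x : Tm) : Tm :=
  con IndTr · A · (λ _, X) · (λ _, h) · c · x.
Definition tr_in (A a : Tm) : Tm := con TrIn · A · a.
Definition absurd (X x : Tm) : Tm := con IndEmpty · (λ _, X) · x.
Definition sig_rec (A : Tm) (B : Tm -> Tm) (X g u : Tm) : Tm :=
  con IndSig · A · lam B · (λ _, X) · g · u.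
Definition inl (A B a : Tm) : Tm := con Inl · A · B · a.
Definition inr (A B b : Tm) : Tm := con Inr · A · B · b.
Definition sum_ind (A B : Tm) (C : Tm -> Tm) (l r x : Tm) : Tm :=
  con IndSum · A · B · lam C · l · r · x.

Definition isProp_Empty : Tm := λ a, λ b, absurd (eqt (con Empty) a b) a.

(** Recovers [¬A] from [‖¬A‖]: truncation can be eliminated into [Empty]. *)
Definition tr_neg_elim (A t a : Tm) : Tm :=
  tr_rec (neg A) (con Empty) isProp_Empty (λ n, n · a) t.

Definition ap (A B f x y p : Tm) : Tm :=
  con J · A · (λ a, λ b, λ _, eqt B (f · a) (f · b)) · (λ a, refl B (f · a))
    · x · y · p.

(** Equivalent to [P + ¬P], and a proposition whenever [P] is one, without
    function extensionality. *)
Definition decision (P : Tm) : Tm := coprod P (tr (neg P)).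

Definition isProp_decision_ty (i : nat) : Tm :=
  Π P : univ i, isProp P ~> isProp (decision P).

(** Two decisions of the same kind are equal since both summands are propositions;
    two of different kinds contradict each other. *)
Definition isProp_decision : Tm :=
  λ P, λ h, λ x, λ y,
  let T := tr (neg P) in
  let X := decision P in
  sum_ind P T (fun x => Π y : X, eqt X x y)
    (λ p, λ y, sum_ind P T (fun y => eqt X (inl P T p) y)
       (λ q, ap P X (con Inl · P · T) p q (h · p · q))
       (λ t, absurd (eqt X (inl P T p) (inr P T t)) (tr_neg_elim P t p))
       y)
    (λ s, λ y, sum_ind P T (fun y => eqt X (inr P T s) y)
       (λ q, absurd (eqt X (inr P T s) (inl P T q)) (tr_neg_elim P s q))
       (λ t, ap T X (con Inr · P · T) s t (con TrPath · neg P · s · t))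
       y)
    x · y.

Lemma typ_isProp_decision G i : wf G ->
  typ G (isProp_decision 0) (isProp_decision_ty i 0).
Proof. by move=> wfG; typecheck i.+2. Qed.

(** * Excluded middle from Foundation *)

Definition mem_intro_ty (i : nat) (mem : Tm) : Tm :=
  Π x : Vt i, Π A : univ i, Π f : A ~> Vt i,
    (∃ a : A, eqt (Vt i) x (f · a)) ~> inV i mem x (setV i A f).

Definition mem_elim_ty (i : nat) (mem : Tm) : Tm :=
  Π x : Vt i, Π A : univ i, Π f : A ~> Vt i,
    inV i mem x (setV i A f) ~> ∃ a : A, eqt (Vt i) x (f · a).

Definition disjointV (i : nat) (mem x v : Tm) : Tm :=
  Π y : Vt i, neg (times (inV i mem y x) (inV i mem y v)).

Definition foundation_ty (i : nat) (mem : Tm) : Tm :=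
  Π v : Vt i, neg (Π y : Vt i, neg (inV i mem y v)) ~>
    ∃ x : Vt i, times (inV i mem x v) (disjointV i mem x v).

(** Any [v] = {e | P} ∪ {one} with [e] in [one] decides [P].  The set [v] is
    described by its membership relation only. *)
Definition decided_by_sets_ty (i : nat) (mem : Tm) : Tm :=
  Π P : univ i, isProp (decision P) ~> Π e : Vt i, Π one : Vt i, Π v : Vt i,
    inV i mem e one ~> inV i mem one v ~> (P ~> inV i mem e v) ~>
    (Π x : Vt i, inV i mem x v ~> disj P (eqt (Vt i) x one)) ~>
    coprod P (neg P).

(** Foundation for [v] gives an element [x] disjoint from [v].  In the case
    [x = one], transport along the equation puts [e] into [x], and [P] puts [e]
    into [v], against disjointness. *)
Definition decide_by_foundation (i : nat) : Tm :=
  λ mem, λ found, λ P, λ hX, λ e, λ one, λ v,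
  λ e_one, λ one_v, λ e_v, λ cases,
  let T := tr (neg P) in
  let X := decision P in
  let E x := eqt (Vt i) x one in
  let minimal x := times (inV i mem x v) (disjointV i mem x v) in
  let e_in x q :=
    con J · Vt i · (λ a, λ b, λ _, inV i mem e b ~> inV i mem e a)
      · (λ _, λ z, z) · x · one · q · e_one in
  let decide x m k :=
    tr_rec (coprod P (E x)) X hX
      (λ c, sum_ind P (E x) (fun _ => X)
         (λ p, inl P T p)
         (λ q, inr P T (tr_in (neg P) (λ p,
            k · e · tpair (inV i mem e x) (fun _ => inV i mem e v)
                      (e_in x q) (e_v · p))))
         c)
      (cases · x · m) in
  let decided :=
    tr_rec (sig (Vt i) minimal) X hX
      (λ u, sig_rec (Vt i) minimal X
         (λ x, λ mk, sig_rec (inV i mem x v) (fun _ => disjointV i mem x v) X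
            (λ m, λ k, decide x m k) mk) u)
      (found · v · (λ n, n · one · one_v)) in
  sum_ind P T (fun _ => coprod P (neg P))
    (λ p, inl P (neg P) p)
    (λ t, inr P (neg P) (λ p, tr_neg_elim P t p))
    decided.

Lemma typ_decide_by_foundation G i : wf G ->
  typ G (decide_by_foundation i 0)
    ((Π mem : mem_rel i, foundation_ty i mem ~> decided_by_sets_ty i mem) 0).
Proof. by move=> wfG; typecheck i.+2. Qed.

Definition lem_by_sets_ty (i : nat) (mem : Tm) : Tm :=
  mem_intro_ty i mem ~> mem_elim_ty i mem ~>
  decided_by_sets_ty i mem ~> isProp_decision_ty i ~>
  Π e : Vt i, Π one : Vt i, inV i mem e one ~> LEM i.

(** The set [v] is [set (P + 1, f)], with [f] constant on each summand.  That
    [e] and [one] are values of [f] is witnessed by reflexivity, through the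
    computation rules for sums. *)
Definition lem_by_sets (i : nat) : Tm :=
  λ mem, λ intro, λ elim, λ decide, λ hX, λ e, λ one, λ e_one, λ P, λ h,
  let A := coprod P (con Unit) in
  let f := con IndSum · P · con Unit · (λ _, Vt i) · (λ _, e) · (λ _, one) in
  let v := setV i A f in
  let fiber x w := eqt (Vt i) x (f · w) in
  let mem_intro x w :=
    intro · x · A · f
      · tr_in (sig A (fiber x)) (tpair A (fiber x) w (refl (Vt i) x)) in
  let X x := coprod P (eqt (Vt i) x one) in
  let cases x m :=
    tr_rec (sig A (fiber x)) (tr (X x)) (con TrPath · X x)
      (λ u, sig_rec A (fiber x) (tr (X x))
         (λ w, λ q, sum_ind P (con Unit) (fun w => fiber x w ~> tr (X x))
            (λ p, λ _, tr_in (X x) (inl P (eqt (Vt i) x one) p))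
            (λ _, λ q, tr_in (X x) (inr P (eqt (Vt i) x one) q))
            w · q) u)
      (elim · x · A · f · m) in
  decide · P · (hX · P · h) · e · one · v
    · e_one
    · mem_intro one (inr P (con Unit) (con Star))
    · (λ p, mem_intro e (inl P (con Unit) p))
    · (λ x, λ m, cases x m).

Lemma typ_lem_by_sets G i : wf G ->
  typ G (lem_by_sets i 0) ((Π mem : mem_rel i, lem_by_sets_ty i mem) 0).
Proof. by move=> wfG; typecheck i.+2. Qed.

Definition lem_of_foundation_ty (i : nat) (mem : Tm) : Tm :=
  mem_intro_ty i mem ~> mem_elim_ty i mem ~> foundation_ty i mem ~> LEM i.

(** The previous steps are arguments here, with their types as annotations; they
    are supplied in [typ_lem_term].  What remains is to exhibit an [e] and a set
    containing it: the empty set and its singleton. *)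
Definition lem_by_empty_set (i : nat) : Tm :=
  λ s1, λ s2, λ hX, λ mem, λ intro, λ elim, λ found,
  let e := setV i (con Empty) (λ a, absurd (Vt i) a) in
  let one := setV i (con Unit) (λ _, e) in
  let fiber b := eqt (Vt i) e ((λ _, e) · b) in
  s2 · mem · intro · elim · (s1 · mem · found) · hX · e · one
    · (intro · e · con Unit · (λ _, e)
         · tr_in (sig (con Unit) fiber)
             (tpair (con Unit) fiber (con Star) (refl (Vt i) e))).

Lemma typ_lem_by_empty_set G i : wf G ->
  typ G (lem_by_empty_set i 0)
    (((Π mem : mem_rel i, foundation_ty i mem ~> decided_by_sets_ty i mem) ~>
     (Π mem : mem_rel i, lem_by_sets_ty i mem) ~>
     isProp_decision_ty i ~>
     Π mem : mem_rel i, lem_of_foundation_ty i mem) 0).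
Proof. by move=> wfG; typecheck i.+2. Qed.

Lemma typ_arrow_app G f a A B : typ G f ((A ~> B) 0) -> typ G a (A 0) ->
  inst (B 1) a = B 0 -> typ G (f $ a) (B 0).
Proof. exact: typ_app. Qed.

Definition lem_term (i : nat) : tm :=
  lem_by_empty_set i 0 $ decide_by_foundation i 0 $ lem_by_sets i 0
    $ isProp_decision 0.

Lemma typ_lem_term G i : wf G ->
  typ G (lem_term i) ((Π mem : mem_rel i, lem_of_foundation_ty i mem) 0).
Proof.
move=> wfG.
have t1 := typ_arrow_app (typ_lem_by_empty_set i wfG)
  (typ_decide_by_foundation i wfG) (erefl _).
have t2 := typ_arrow_app t1 (typ_lem_by_sets i wfG) (erefl _).
exact: typ_arrow_app t2 (typ_isProp_decision i wfG) (erefl _).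
Qed.

(** * Instantiation at a given membership relation *)

Lemma typ_mem i mem G : is_membership i mem -> wf G -> typ G mem (mem_rel i 0).
Proof. by move=> [tm _] wfG; apply: (typ_weaken wfG tm). Qed.

Definition up (s : nat -> tm) : nat -> tm :=
  scons (Var 0) (fun n => ren succn (s n)).

Lemma conv_beta3 b x y z :
  conv (Lam (Lam (Lam b)) $ x $ y $ z)
    (sub (scons z Var) (sub (up (scons y Var)) (sub (up (up (scons x Var))) b))).
Proof.
apply: conv_trans
  (conv_App (conv_App (conv_beta _ _) (conv_refl _)) (conv_refl _)) _.
apply: conv_trans (conv_App (conv_beta _ _) (conv_refl _)) _.
exact: conv_beta.
Qed.

(** The defining equation of membership is an equation between abstractions.
    It is instantiated at variables, which are all that the introduction and
    elimination principles apply it to. *)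
Lemma elem_conv i mem a b c : is_membership i mem ->
  conv (elem i mem (Var a) (SetV i $ Var b $ Var c))
       (Tr $ (Sig $ Var b $ Lam (Id $ V i $ Var a.+1 $ (Var c.+1 $ Var 0)))).
Proof.
move=> [/typ_sub mem_sub lr].
have := conv_App (conv_App (conv_App lr (conv_refl (Var a)))
  (conv_refl (Var b))) (conv_refl (Var c)).
move=> {}lr; apply: conv_trans (conv_trans lr (conv_beta3 _ _ _ _)).
apply: conv_trans (conv_sym (conv_beta3 _ _ _ _)).
by rewrite /= !mem_sub //; exact: conv_refl.
Qed.

Lemma typ_foundation G i mem : is_membership i mem -> wf G ->
  typ G (foundation_ty i (closed mem) 0) (Univ i.+1).
Proof.
move=> hmem wfG; have tm D := @typ_mem i mem D hmem.
by vm_compute; check_type i.+2 i.+1.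
Qed.

(** [λ x A f p. p]: since both sides of the defining equation of membership have
    the same elements, it proves introduction as well as elimination. *)
Definition mem_id : tm := Lam (Lam (Lam (Lam (Var 0)))).

Lemma typ_mem_intro G i mem : is_membership i mem -> wf G ->
  typ G mem_id (mem_intro_ty i (closed mem) 0).
Proof.
move=> hmem wfG; have tm D := @typ_mem i mem D hmem.
vm_compute.
do 4 (apply: (@typ_Lam' _ _ _ _ i.+2); [check_type i.+2 i.+2 | intro]).
apply: (typ_conv (i := i.+2)); last by check_type i.+2 i.+2.
  by infer i.+2.
exact: conv_sym (elem_conv 3 2 1 hmem).
Qed.

Lemma typ_mem_elim G i mem : is_membership i mem -> wf G ->
  typ G mem_id (mem_elim_ty i (closed mem) 0).
Proof.
move=> hmem wfG; have tm D := @typ_mem i mem D hmem.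
vm_compute.
do 4 (apply: (@typ_Lam' _ _ _ _ i.+2); [check_type i.+2 i.+2 | intro]).
apply: (typ_conv (i := i.+2)); last by check_type i.+2 i.+2.
  eapply typ_eq; first by eapply typ_Var; [eassumption | reflexivity].
  by have [/typ_ren mem_ren _] := hmem; rewrite /= mem_ren.
exact: elem_conv 3 2 1 hmem.
Qed.

Definition foundation : form :=
  FAll 0 (FImp (FNot (FEmpty 0 1))
    (FEx 1 (FAnd (FIn 1 0) (FAll 2 (FNot (FAnd (FIn 2 1) (FIn 2 0))))))).

Lemma models_foundation i mem :
  models i (closed mem) foundation 0 = foundation_ty i (closed mem) 0.
Proof. by []. Qed.

(** [mem] replaces a variable of the type of [lem_term]; it is closed, so that
    the result mentions [mem] itself under all binders. *)
Lemma typ_lem_term_mem G i mem : is_membership i mem -> wf G ->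
  typ G (lem_term i $ mem $ mem_id $ mem_id)
    ((foundation_ty i (closed mem) ~> LEM i) 0).
Proof.
move=> hmem wfG.
have [/typ_ren mem_ren _] := hmem; have [/typ_sub mem_sub _] := hmem.
pose I := mem_intro_ty i (closed mem); pose E := mem_elim_ty i (closed mem).
pose F := foundation_ty i (closed mem).
have t_mem : typ G (lem_term i $ mem) ((I ~> E ~> F ~> LEM i) 0).
  apply: typ_app (typ_lem_term i wfG) (typ_mem hmem wfG) _.
  by cbv -[ren sub]; rewrite /= ?mem_ren ?mem_sub //.
have t_intro : typ G (lem_term i $ mem $ mem_id) ((E ~> F ~> LEM i) 0).
  apply: typ_arrow_app t_mem (typ_mem_intro hmem wfG) _.
  by cbv -[ren sub]; rewrite /= ?mem_ren ?mem_sub //.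
apply: (@typ_arrow_app _ _ _ E (F ~> LEM i)) t_intro (typ_mem_elim hmem wfG) _.
by cbv -[ren sub]; rewrite /= ?mem_ren ?mem_sub //.
Qed.

Theorem corollary1 (i : nat) (mem : tm) (hmem : is_membership i mem) :
  inhabited_from (V_models_ZF i mem) (LEM i 0).
Proof.
have [/typ_ren mem_ren _] := hmem.
set F := foundation_ty i (closed mem) 0.
have wfF : wf [:: F] by apply: wf_cons (typ_foundation hmem wf_nil).
have F0 : onth [:: F] 0 = Some F by [].
have tF : typ [:: F] (Var 0) F.
  apply: typ_eq (typ_Var wfF F0) _.
  by rewrite /F; cbv -[ren]; rewrite /= !mem_ren.
exists [:: F], (lem_term i $ mem $ mem_id $ mem_id $ Var 0); split.
  case=> [|[]] //= T [<-]; exists foundation; last by rewrite models_foundation.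
  exact: zf_foundation.
exact: typ_arrow_app (typ_lem_term_mem hmem wfF) tF (erefl _).
Qed.
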